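(* Let $G=(V,E)$ be a finite simple undirected graph with $V=\{1,\ldots,N\}$, let $\gamma>0$, and consider the logistic dynamical system $$\frac{d}{dt}y_i(t)=\Big(\sum_{j\sim i}\gamma\, y_j(t)\Big)(1-y_i(t))-y_i(t),\qquad i=1,\ldots,N.$$ This system preserves the coarsest equitable partition of $G$, i.e., with $\cong$ the equivalence relation defined in the context (whose classes form the coarsest equitable partition of $G$): if $\mathbf{y}(0)\in[0,1]^N$ satisfies $y_i(0)=y_j(0)$ for all $i\cong j$, then the solution $\mathbf{y}(t,\mathbf{y}(0))$ with initial condition $\mathbf{y}(0)$ satisfies $$y_i(t,\mathbf{y}(0))=y_j(t,\mathbf{y}(0))\quad\text{for all } t\ge 0 \text{ and all } i\cong j.$$
   Context: $\mathbb{N}=\{1,2,3,\ldots\}$; $a\sim b$ means that $a,b\in V$ are neighbors in $G$; $\mathcal{N}(a)$ is the set of neighbors of $a$; $d(a)$ is the degree of $a$. For $\ell\in\mathbb{N}$ and $i\in V$, the set of paths (walks) of length $\ell$ departing from $i$ is $$\mathcal{P}_\ell(i)=\{(i_0,i_1,\ldots,i_\ell)\in V^{\ell+1} : i_0=i,\ i_k\sim i_{k+1}\ \text{for } 0\le k\le \ell-1\}.$$ For $0\le m\le \ell$, $\pi_{\le m}(x_0,x_1,\ldots,x_\ell)=(x_0,\ldots,x_m)$. For a vector of nodes $\mathbf{p}$, $\mathbf{d}(\mathbf{p})$ is the vector of the degrees of its entries; inequalities between vectors are componentwise. For $i,j\in V$ and $\ell\in\mathbb{N}$, a function $f^\ell_{ji}:\mathcal{P}_\ell(j)\to\mathcal{P}_\ell(i)$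 is called $\ell$-adapted at $(j,i)$ if for all $\mathbf{p},\widetilde{\mathbf{p}}\in\mathcal{P}_\ell(j)$ and all $m\le\ell$: $\pi_{\le m}(\mathbf{p})=\pi_{\le m}(\widetilde{\mathbf{p}})$ implies $\pi_{\le m}(f^\ell_{ji}(\mathbf{p}))=\pi_{\le m}(f^\ell_{ji}(\widetilde{\mathbf{p}}))$, and $\pi_{\le m}(\mathbf{p})\ne\pi_{\le m}(\widetilde{\mathbf{p}})$ implies $\pi_{\le m}(f^\ell_{ji}(\mathbf{p}))\ne\pi_{\le m}(f^\ell_{ji}(\widetilde{\mathbf{p}}))$. An adapted sequence at $(j,i)$ is a sequence $(f^\ell_{ji})_{\ell\in\mathbb{N}}$ of $\ell$-adapted functions $f^\ell_{ji}:\mathcal{P}_\ell(j)\to\mathcal{P}_\ell(i)$ such that for every $\ell\in\mathbb{N}$, $f^{\ell+1}_{ji}$ extends $f^\ell_{ji}$, i.e. for all $\mathbf{p}\in\mathcal{P}_\ell(j)$ and $\mathbf{q}\in\mathcal{P}_{\ell+1}(j)$: if $\mathbf{p}=\pi_{\le\ell}(\mathbf{q})$ then $\pi_{\le\ell}(f^{\ell+1}_{ji}(\mathbf{q}))=f^\ell_{ji}(\mathbf{p})$, and if $\mathbf{p}\ne\pi_{\le\ell}(\mathbf{q})$ then $\pi_{\le\ell}(f^{\ell+1}_{ji}(\mathbf{q}))\ne f^\ell_{ji}(\mathbf{p})$. Definition of $\succeq$: $i\succeq j$ if there exists an adapted sequence $(f^\ell_{ji})_{\ell\in\mathbb{N}}$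 at $(j,i)$ such that for all $\ell\in\mathbb{N}$, $f^\ell_{ji}$ is injective and $\mathbf{d}(f^\ell_{ji}(\mathbf{p}))\ge\mathbf{d}(\mathbf{p})$ for all $\mathbf{p}\in\mathcal{P}_\ell(j)$. Definition of $\cong$: $i\cong j$ if and only if $i\succeq j$ and $j\succeq i$. Equitable partitions: for a partition $\mathcal{P}=\{\mathcal{P}_1,\ldots,\mathcal{P}_k\}$ of $V$, put $s_r(i)=|\mathcal{N}(i)\cap\mathcal{P}_r|$ and $\mathbf{s}(i)=(s_1(i),\ldots,s_k(i))$. The partition $\mathcal{P}$ is equitable if for all $i,j\in V$: $i$ and $j$ lie in the same block of $\mathcal{P}$ if and only if $\mathbf{s}(i)=\mathbf{s}(j)$. The coarsest equitable partition of $G$ is the equitable partition that is coarser than (or equal to) every equitable partition of $G$; its blocks are the $\cong$-classes. *)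

(* Defs.v *)
From HB Require Import structures.
From mathcomp Require Import all_boot all_order all_algebra.
From mathcomp Require Import all_classical all_reals all_analysis.

Set Implicit Arguments.
Unset Strict Implicit.
Unset Printing Implicit Defensive.

Import Order.TTheory GRing.Theory Num.Theory.
Import numFieldNormedType.Exports.

Section Graph.
Variables (N : nat) (e : rel 'I_N).

Definition nbrs (a : 'I_N) : {set 'I_N} := [set b | e a b].

Definition deg (a : 'I_N) : nat := #|nbrs a|.

(* Walks of length l have l + 1 entries. *)
Definition walk (l : nat) (i : 'I_N) :=
  {p : l.+1.-tuple 'I_N | (thead p == i) && sorted e p}.

Definition pi_le (m l : nat) (i : 'I_N) (p : walk l i) : seq 'I_N :=
  take m.+1 (\val p).

Definition adapted (l : nat) (j i : 'I_N) (f : walk l j -> walk l i) : Prop :=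
  forall (p q : walk l j) (m : nat), (m <= l)%N ->
    (pi_le m p = pi_le m q -> pi_le m (f p) = pi_le m (f q)) /\
    (pi_le m p <> pi_le m q -> pi_le m (f p) <> pi_le m (f q)).

Definition extends (l : nat) (j i : 'I_N)
    (f : walk l j -> walk l i) (g : walk l.+1 j -> walk l.+1 i) : Prop :=
  forall (p : walk l j) (q : walk l.+1 j),
    (\val p = pi_le l q :> seq 'I_N ->
       pi_le l (g q) = \val (f p) :> seq 'I_N) /\
    (\val p <> pi_le l q :> seq 'I_N ->
       pi_le l (g q) <> \val (f p) :> seq 'I_N).

(* Lengths start at 1: the component f 0 (which always exists, walk 0 j being
   a singleton) is a dummy, subject to no condition. *)
Definition adapted_seq (j i : 'I_N)
    (f : forall l : nat, walk l j -> walk l i) : Prop :=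
  forall l : nat, (0 < l)%N -> adapted (f l) /\ extends (f l) (f l.+1).

Definition succeq (i j : 'I_N) : Prop :=
  exists f : forall l : nat, walk l j -> walk l i,
    adapted_seq f /\
    forall l : nat, (0 < l)%N ->
      injective (f l) /\
      forall (p : walk l j) (k : 'I_l.+1),
        (deg (tnth (\val p) k) <= deg (tnth (\val (f l p)) k))%N.

Definition cong (i j : 'I_N) : Prop := succeq i j /\ succeq j i.

Definition same_block (P : {set {set 'I_N}}) (i j : 'I_N) : Prop :=
  exists2 B : {set 'I_N}, B \in P & (i \in B) && (j \in B).

(* The equivalence is deliberate: vertices with the same neighbour counts
   must lie in a common block, which is more than the usual one-way
   condition asks. *)
Definition equitable (P : {set {set 'I_N}}) : Prop :=
  finset.partition P [set: 'I_N] /\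
  forall i j : 'I_N,
    same_block P i j <->
    (forall B : {set 'I_N}, B \in P -> #|nbrs i :&: B| = #|nbrs j :&: B|).

Definition coarsest_equitable (P : {set {set 'I_N}}) : Prop :=
  equitable P /\
  forall Q : {set {set 'I_N}}, equitable Q ->
    forall B : {set 'I_N}, B \in Q ->
      exists2 C : {set 'I_N}, C \in P & B \subset C.

End Graph.

Section Logistic.
Local Open Scope ring_scope.
Local Open Scope classical_set_scope.
Variables (R : realType) (N : nat) (e : rel 'I_N).

Definition logistic_rhs (gamma : R) (x : 'I_N -> R) (i : 'I_N) : R :=
  (\sum_(j < N | e i j) gamma * x j) * (1 - x i) - x i.

(* Solutions live on [0, +oo[: the derivative at 0 is the right derivative,
   and the values of y at negative times are irrelevant. *)
Definition logistic_solution (gamma : R) (y : 'I_N -> R -> R) : Prop :=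
  forall i : 'I_N,
    (forall t : R, 0 < t ->
       is_derive t 1 (y i) (logistic_rhs gamma (fun j => y j t) i)) /\
    (h^-1 * (y i h - y i 0) @[h --> 0^'+] -->
       logistic_rhs gamma (fun j => y j 0) i).

End Logistic.

(* Main.v *)
Require Import Defs.
From HB Require Import structures.
From mathcomp Require Import all_boot all_order all_algebra.
From mathcomp Require Import all_classical all_reals all_analysis.
From mathcomp Require Import ring lra.

(** The proof rests on a coinductive reading of [succeq].  An adapted sequence
    of injections from the walks at [j] to the walks at [i] is a level-preserving
    embedding of the tree of walks at [j] into the tree of walks at [i].  Such an
    embedding sends the children of the root injectively to children of the
    root, and restricts to an embedding of each subtree; conversely embeddings
    of the subtrees can be glued.  So [succeq] is the greatest relation [S] such
    that [S i j] yields an injection [phi] from the neighbours of [j] to those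
    of [i] with [S (phi a) a] ([succeq_step], [succeq_coind]).  The degree
    inequality along a walk comes from these injections, the degree of a vertex
    being its number of children in the tree.

    Partition part.  [succeq] is a preorder and [cong] its symmetric part.  If
    [cong i j], the two injections show that any upward closed set contains as
    many neighbours of [i] as of [j]; a [cong]-class is a difference of two such
    sets, hence it too meets both neighbourhoods equally often
    ([cong_card_class]).  Conversely, if the classes of a partition meet two
    neighbourhoods equally often, there is a block-preserving injection between
    them ([block_injection]).  For the partition into [cong]-classes this gives
    the other half of equitability; for an arbitrary equitable partition
    it makes the relation of lying in the same block a coinduction witness,
    so every equitable partition refines the [cong]-classes.

    Dynamical part.  Let [u] be the family of all differences [y a - y b] with
    [cong a b].  Since [cong]-equivalent vertices have neighbourhoods matched by
    a [cong]-preserving bijection, each derivative of a member of [u] is bounded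
    by a constant times the sum of the absolute values of all the members, as
    long as [y] stays bounded ([logistic_rhs_cong]); boundedness on a compact
    time interval follows from continuity.  Gronwall's inequality
    ([gronwall_eq0]) then keeps [u] at its initial value 0. *)

Set Implicit Arguments.
Unset Strict Implicit.
Unset Printing Implicit Defensive.

Import Order.TTheory GRing.Theory Num.Theory.
Import numFieldNormedType.Exports.
Local Open Scope ring_scope.

(** * Walk trees and the relation [succeq] *)

Section Walks.
Local Open Scope nat_scope.
Variables (N : nat) (e : rel 'I_N).
Implicit Types (i j a b : 'I_N) (s : seq 'I_N) (S : 'I_N -> 'I_N -> Prop).

(** The start of a walk is known from its type, so only the remaining entries
    carry information; working with them as plain sequences avoids transport
    between the types of walks of different lengths. *)
Definition walk_steps l i (p : walk e l i) : seq 'I_N := behead (val (val p)).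

Lemma walkE l i (p : walk e l i) : val (val p) = i :: walk_steps p :> seq 'I_N.
Proof.
have /andP[/eqP + _] := valP p; rewrite /walk_steps /thead (tnth_nth i).
by case: (val p) => -[|a s] //= _ ->.
Qed.

Lemma walk_stepsP l i (p : walk e l i) :
  path e i (walk_steps p) /\ size (walk_steps p) = l.
Proof.
have E := walkE p; split; last by rewrite size_behead size_tuple.
by have /andP[_] := valP p; rewrite E.
Qed.

Lemma walk_steps_inj l i : injective (@walk_steps l i).
Proof. by move=> p q E; do 2!apply: val_inj; rewrite !walkE E. Qed.

Lemma exists_walk l i s :
  path e i s -> size s = l -> {p : walk e l i | walk_steps p = s}.
Proof.
move=> ps ss; have H : size (i :: s) == l.+1 by rewrite /= ss.
have Hw : (thead (Tuple H) == i) && sorted e (Tuple H).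
  by rewrite /thead (tnth_nth i)/= eqxx ps.
by exists (Sub (Tuple H) Hw).
Qed.

Lemma pi_leE m l i (p : walk e l i) : pi_le m p = i :: take m (walk_steps p).
Proof. by rewrite /pi_le walkE. Qed.

(** An adapted sequence of injections amounts to a single function on sequences
    that commutes with truncation: the compatibility of consecutive lengths and
    the adaptedness at each length merge into one equation. *)
Definition walk_embedding i j (F : seq 'I_N -> seq 'I_N) : Prop :=
  forall s, path e j s ->
    [/\ path e i (F s), size (F s) = size s,
        forall m, F (take m s) = take m (F s)
      & forall s', path e j s' -> F s = F s' -> s = s'].

Lemma path_take i s m : path e i s -> path e i (take m s).
Proof. by rewrite -{1}(cat_take_drop m s) cat_path => /andP[]. Qed.

Lemma succeq_walk_embedding i j : succeq e i j -> exists F, walk_embedding i j F.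
Proof.
case=> f [fad finj].
pose F s : seq 'I_N :=
  if @idP (path e j s) is ReflectT ps
  then walk_steps (f _ (sval (exists_walk ps erefl))) else s.
have FE l (p : walk e l j) : F (walk_steps p) = walk_steps (f l p).
  have [ps ss] := walk_stepsP p.
  have fE l' (q : walk e l' j) : l' = l -> walk_steps q = walk_steps p ->
      walk_steps (f l' q) = walk_steps (f l p).
    by move=> E; subst l' => /walk_steps_inj->.
  rewrite /F; case: {-}_ / idP => // {}ps.
  by apply: fE => //; exact: (svalP (exists_walk ps erefl)).
(* One step of truncation, from the extension property.  For the empty sequence
   the component of index 0 is unconstrained, but it has only one possible
   value. *)
have FS s x : path e j (rcons s x) -> F s = take (size s) (F (rcons s x)).
  move=> pr; have ps : path e j s by move: pr; rewrite rcons_path => /andP[].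
  have [p Ep] := exists_walk ps erefl.
  have [|q Eq] := @exists_walk (size s).+1 _ _ pr; first by rewrite size_rcons.
  rewrite -{1}Ep -Eq !FE.
  case: s => [|a s] in ps x pr p q Ep Eq *.
    by rewrite take0; apply: size0nil; rewrite (walk_stepsP _).2.
  have [_ /(_ p q)[+ _]] := fad (size (a :: s)) isT.
  rewrite walkE Ep !pi_leE Eq -cats1 take_size_cat // => /(_ erefl).
  by rewrite (walkE (f _ p)) => -[].
exists F => s ps; have [p Ep] := exists_walk ps erefl.
have Fsz : size (F s) = size s by rewrite -{1}Ep FE (walk_stepsP _).2.
split=> [||m|s' ps' EF] //; first by rewrite -Ep FE (walk_stepsP _).1.
- case: (leqP (size s) m) => [le_sm|]; first by rewrite !take_oversize ?Fsz.
  elim/last_ind: s ps {p Ep Fsz} m => // s x IHs ps m.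
  have ps' : path e j s by move: ps; rewrite rcons_path => /andP[].
  rewrite size_rcons ltnS => le_ms; rewrite -cats1 takel_cat // cats1.
  have -> : take m (F (rcons s x)) = take m (take (size s) (F (rcons s x))).
    by rewrite take_takel.
  rewrite -(FS _ _ ps); move: le_ms.
  rewrite leq_eqVlt => /predU1P[->|]; last exact: IHs.
  by rewrite take_size (FS _ _ ps) take_takel.
- have [p' Ep'] := exists_walk ps' erefl.
  have Fsz' : size (F s') = size s' by rewrite -{1}Ep' FE (walk_stepsP _).2.
  have Es : size s = size s' by rewrite -Fsz EF.
  have [|q Eq] := @exists_walk (size s) _ _ ps'; first by [].
  have [s0|s_gt0] := posnP (size s).
    by rewrite (size0nil s0) (@size0nil _ s') // -Es.
  have [fi _] := finj _ s_gt0.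
  rewrite -Ep -Eq; congr walk_steps; apply: fi; apply: walk_steps_inj.
  by rewrite -!FE Ep Eq.
Qed.

(** One unfolding of the embedding relation: the children of the two roots are
    matched injectively, and the subtrees are related by [S]. *)
Definition nbr_injection S i j : Prop :=
  exists phi : 'I_N -> 'I_N, {in nbrs e j &, injective phi} /\
    forall a, a \in nbrs e j -> phi a \in nbrs e i /\ S (phi a) a.

(** Commutation with truncation to length 1 makes the first step of the image
    depend only on the first step [a] of the walk, which defines [phi]; fixing
    [a] and dropping the first step of the image embeds the subtree at [a]. *)
Lemma walk_embedding_step i j :
  (exists F, walk_embedding i j F) ->
  nbr_injection (fun i' j' => exists F, walk_embedding i' j' F) i j.
Proof.
case=> F FE.
have [phi phiE] : exists phi, forall a, a \in nbrs e j -> F [:: a] = [:: phi a].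
  exists (fun a => head a (F [:: a])) => a; rewrite inE => ja.
  have [|_ + _ _] := FE [:: a]; first by rewrite /= ja.
  by case: (F [:: a]) => [|b []].
exists phi.
have F0 : F [::] = [::] by have [|_ /size0nil ->] := FE [::].
split=> [a b ja jb Eab|a ja].
  have pa : path e j [:: a] by move: ja; rewrite inE /= andbT.
  have pb : path e j [:: b] by move: jb; rewrite inE /= andbT.
  have [_ _ _ /(_ _ pb)] := FE _ pa.
  by rewrite !phiE // Eab => /(_ erefl) [].
have pa : path e j [:: a] by move: ja; rewrite inE /= andbT.
have [+ _ _ _] := FE _ pa; rewrite phiE //= inE andbT => ->; split=> //.
exists (fun s => behead (F (a :: s))) => s pas.
have consE s' : path e a s' ->
    F (a :: s') = phi a :: behead (F (a :: s')).
  move=> ps'; have [|_ + /(_ 1) + _] := FE (a :: s').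
    by move: ja; rewrite inE /= => ->.
  case: (F (a :: s')) => // b r _; rewrite /= take0 phiE //.
  by case=> ->; rewrite take0.
have ps : path e j (a :: s) by move: ja; rewrite inE /= => ->.
have [+ + Ft Fi] := FE _ ps; rewrite consE //= => /andP[_ ->] [->].
split=> // [m|s' pas' E].
  by rewrite -[a :: take m s]/(take m.+1 (a :: s)) Ft consE.
have ps' : path e j (a :: s') by move: ja; rewrite inE /= => ->.
suff [] : a :: s = a :: s' by [].
by apply: Fi => //; rewrite (consE _ pas) (consE _ pas') E.
Qed.

Lemma nbr_injectionW S S' i j :
  (forall a b, S a b -> S' a b) -> nbr_injection S i j -> nbr_injection S' i j.
Proof.
move=> SS' [phi [phiI phiS]]; exists phi; split=> // a /phiS[? ?].
by split=> //; apply: SS'.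
Qed.

Lemma nbr_injection_deg S i j : nbr_injection S i j -> deg e j <= deg e i.
Proof.
case=> phi [phiI phiS]; rewrite /deg -(card_in_imset phiI).
by apply/fintype.subset_leq_card/fintype.subsetP => _ /imsetP[a /phiS[? _] ->].
Qed.

Section Coinduction.
Variable phi : 'I_N -> 'I_N -> 'I_N -> 'I_N.

(** The glued embedding: [phi i j] chooses the image of the first step, and the
    rest of the walk is mapped by the embedding between the vertices reached. *)
Fixpoint lift_steps i j s : seq 'I_N :=
  if s is a :: s' then phi i j a :: lift_steps (phi i j a) a s' else [::].

Lemma size_lift_steps i j s : size (lift_steps i j s) = size s.
Proof. by elim: s i j => //= a s IHs i j; rewrite IHs. Qed.

Lemma take_lift_steps m i j s :
  take m (lift_steps i j s) = lift_steps i j (take m s).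
Proof. by elim: s m i j => [|a s IHs] [|m] i j //=; rewrite IHs. Qed.

Variable S : 'I_N -> 'I_N -> Prop.
Hypothesis phiI : forall i j, S i j -> {in nbrs e j &, injective (phi i j)}.
Hypothesis phiS : forall i j, S i j ->
  forall a, a \in nbrs e j -> phi i j a \in nbrs e i /\ S (phi i j a) a.

Lemma lift_stepsP i j s : S i j -> path e j s ->
  path e i (lift_steps i j s) /\
  forall k, k <= size s ->
    deg e (nth j (j :: s) k) <= deg e (nth i (i :: lift_steps i j s) k).
Proof.
have degS i' j' : S i' j' -> deg e j' <= deg e i'.
  move=> Sij; apply: (@nbr_injection_deg S); exists (phi i' j').
  by split; [exact: phiI|exact: phiS].
elim: s i j => [|a s IHs] i j Sij /=; first by split=> // -[]//= _; exact: degS.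
case/andP=> ja pas.
have [] := phiS Sij (_ : a \in nbrs e j); first by rewrite inE.
rewrite inE => iphi Sphi; have [-> degs] := IHs _ _ Sphi pas.
rewrite iphi; split=> // -[_|k]; first exact: degS.
rewrite ltnS /= => le_ks; have := degs k le_ks.
rewrite [nth a _ _](set_nth_default j) //.
rewrite [nth (phi i j a) _ _](set_nth_default i) //=.
by rewrite /= size_lift_steps.
Qed.

Lemma lift_steps_inj i j s s' : S i j -> path e j s -> path e j s' ->
  lift_steps i j s = lift_steps i j s' -> s = s'.
Proof.
elim: s s' i j => [|a s IHs] [|a' s'] //= i j Sij /andP[ja ps] /andP[ja' ps'].
case=> E; have {E}Ea : a = a' by apply: (phiI Sij); rewrite ?inE.
subst a' => /IHs ->//; have [] // := phiS Sij (_ : a \in nbrs e j).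
by rewrite inE.
Qed.

Lemma succeq_lift i j : S i j -> succeq e i j.
Proof.
move=> Sij.
have lP l (p : walk e l j) : {q : walk e l i |
    walk_steps q = lift_steps i j (walk_steps p)}.
  have [ps ss] := walk_stepsP p.
  by apply: exists_walk; [exact: (lift_stepsP Sij ps).1|rewrite size_lift_steps].
pose f l p := sval (lP l p).
have fE l p : walk_steps (f l p) = lift_steps i j (walk_steps p).
  exact: svalP (lP l p).
have injE l l' (p : walk e l j) (q : walk e l' j) m m' :
    take m (lift_steps i j (walk_steps p)) =
      take m' (lift_steps i j (walk_steps q)) ->
    take m (walk_steps p) = take m' (walk_steps q).
  rewrite !take_lift_steps; apply: lift_steps_inj Sij _ _ => //;
    by apply: path_take; exact: (walk_stepsP _).1.
have full l k (p : walk e l k) : take l (walk_steps p) = walk_steps p.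
  by rewrite take_oversize // (walk_stepsP p).2.
exists f; split=> l l_gt0; split.
- move=> p q m le_ml; rewrite !pi_leE !fE; split=> [|pq].
    by rewrite !take_lift_steps => -[->].
  by case=> /injE E; apply: pq; rewrite E.
- move=> p q; rewrite !pi_leE !fE !walkE; split.
    by rewrite take_lift_steps fE => -[->].
  move=> pq; rewrite fE -(full _ _ p) -take_lift_steps.
  by case=> /injE E; apply: pq; rewrite E full.
- move=> p q E; apply: walk_steps_inj; apply: (lift_steps_inj Sij);
    rewrite ?(walk_stepsP _).1 //.
  by rewrite -!fE E.
- move=> p k; rewrite (tnth_nth j) (tnth_nth i) /= !walkE fE.
  have [ps ss] := walk_stepsP p.
  by apply: (lift_stepsP Sij ps).2; rewrite ss -ltnS.
Qed.

End Coinduction.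

(** Choosing one injection for every related pair and following these choices
    along a walk gives a coherent family of maps at all lengths at once. *)
Lemma succeq_coind S :
  (forall i j, S i j -> nbr_injection S i j) ->
  forall i j, S i j -> succeq e i j.
Proof.
move=> step i j Sij.
have [ij|phi phiP] := @choice _ _ (fun ij phi => S ij.1 ij.2 ->
    {in nbrs e ij.2 &, injective phi} /\
    forall a, a \in nbrs e ij.2 -> phi a \in nbrs e ij.1 /\ S (phi a) a).
  case: (pselect (S ij.1 ij.2)) => [/step[phi phiP]|nS]; first by exists phi.
  by exists id => /nS.
apply: (@succeq_lift (fun i j => phi (i, j)) S _ _ _ _ Sij) => i' j' /(phiP (_, _)) [] //.
Qed.

Lemma succeq_step i j : succeq e i j -> nbr_injection (succeq e) i j.
Proof.
move=> /succeq_walk_embedding/walk_embedding_step; apply: nbr_injectionW.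
exact: (succeq_coind walk_embedding_step).
Qed.

Lemma succeq_fold i j : nbr_injection (succeq e) i j -> succeq e i j.
Proof.
apply: succeq_coind => {}i {}j; apply: nbr_injectionW => a b.
exact: succeq_step.
Qed.

Lemma succeq_refl i : succeq e i i.
Proof.
apply: (@succeq_coind (fun i j => i = j)) => // {}i _ <-.
by exists id; split=> [a b _ _ //|a ja]; split.
Qed.

Lemma succeq_trans i j k : succeq e i j -> succeq e j k -> succeq e i k.
Proof.
move=> ij jk.
apply: (@succeq_coind (fun i k => exists2 j, succeq e i j & succeq e j k)).
  move=> {ij jk}i {}k [{}j /succeq_step[f [fI fS]] /succeq_step[g [gI gS]]].
  exists (f \o g); split=> [a b ka kb /= fg|a ka /=].
    by apply: gI => //; apply: fI fg; [exact: (gS _ ka).1|exact: (gS _ kb).1].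
  have [jg ga] := gS _ ka; have [ifg fga] := fS _ jg.
  by split=> //; exists (g a).
by exists j.
Qed.

Lemma cong_refl i : cong e i i.
Proof. by split; apply: succeq_refl. Qed.

Lemma cong_sym i j : cong e i j -> cong e j i.
Proof. by case. Qed.

Lemma cong_trans i j k : cong e i j -> cong e j k -> cong e i k.
Proof. by move=> [ij ji] [jk kj]; split; apply: succeq_trans; eauto. Qed.

(** * The partition into [cong]-classes *)

(** The injection of neighbours moves every vertex upwards, so it maps the part
    lying in an upward closed set into that set. *)
Lemma succeq_card_upset i j (U : {set 'I_N}) : succeq e i j ->
  (forall a b, succeq e a b -> b \in U -> a \in U) ->
  #|nbrs e j :&: U| <= #|nbrs e i :&: U|.
Proof.
move=> /succeq_step[phi [phiI phiS]] upU.
have phiIU : {in nbrs e j :&: U &, injective phi}.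
  by move=> a b /setIP[ja _] /setIP[jb _]; apply: phiI.
rewrite -(card_in_imset phiIU); apply/fintype.subset_leq_card/fintype.subsetP.
move=> _ /imsetP[a /setIP[/phiS[iphi phia] Ua] ->].
by rewrite inE iphi (upU _ _ phia).
Qed.

Lemma cong_card_upset i j (U : {set 'I_N}) : cong e i j ->
  (forall a b, succeq e a b -> b \in U -> a \in U) ->
  #|nbrs e i :&: U| = #|nbrs e j :&: U|.
Proof.
by move=> [ij ji] upU; apply/eqP; rewrite eqn_leq !succeq_card_upset.
Qed.

Definition cong_class i : {set 'I_N} := [set j | `[< cong e i j >]].

(** The class of [a] is the set of vertices above [a] minus the set of vertices
    strictly above [a], both of which are upward closed. *)
Lemma cong_card_class i j a : cong e i j ->
  #|nbrs e i :&: cong_class a| = #|nbrs e j :&: cong_class a|.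
Proof.
move=> cij.
pose U := [set b | `[< succeq e b a >]].
pose V := [set b | `[< succeq e b a /\ ~ succeq e a b >]].
have VU : V \subset U by apply/fintype.subsetP => b; rewrite !inE => -[].
have -> : cong_class a = U :\: V.
  apply/setP => b; rewrite !inE; apply/asboolP/andP.
    by case=> ab ba; split; [apply/asboolPn => -[_]|apply/asboolP].
  move=> [/asboolPn nV /asboolP ba]; split=> //.
  by apply: contrapT => nab; apply: nV.
rewrite !finset.setIDA !cardsD -!finset.setIA (finset.setIidPr VU).
congr (_ - _); apply: cong_card_upset => // b c bc; rewrite !inE.
  exact: succeq_trans.
move=> [ca nac]; split; first exact: succeq_trans bc ca.
by move=> ab; apply: nac; apply: succeq_trans ab bc.
Qed.

Lemma same_block_pblock (P : {set {set 'I_N}}) i j :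
  finset.partition P [set: 'I_N] -> same_block P i j <-> j \in finset.pblock P i.
Proof.
move=> PP; have /and3P[/eqP cP tP _] := PP.
have iP : i \in finset.cover P by rewrite cP inE.
split=> [[B BP /andP[iB jB]]|jPi]; first by rewrite (finset.def_pblock tP BP).
by exists (finset.pblock P i); rewrite ?finset.pblock_mem // finset.mem_pblock iP.
Qed.

(** Inside each block, the vertices of [A] are matched with those of [B] by their
    rank in the enumeration of the finite sets. *)
Lemma block_injection (P : {set {set 'I_N}}) (A B : {set 'I_N}) :
  finset.partition P [set: 'I_N] ->
  (forall C, C \in P -> #|A :&: C| = #|B :&: C|) ->
  exists phi : 'I_N -> 'I_N, {in A &, injective phi} /\
    forall a, a \in A -> phi a \in B /\ same_block P (phi a) a.
Proof.
move=> PP cAB; have /and3P[/eqP cP tP _] := PP.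
have covP a : a \in finset.cover P by rewrite cP inE.
pose C a := finset.pblock P a.
(* The default value [a] of [nth] is never reached, by [idx] below. *)
pose phi a := nth a (enum (B :&: C a)) (index a (enum (A :&: C a))).
have idx a : a \in A -> index a (enum (A :&: C a)) < size (enum (B :&: C a)).
  move=> aA; rewrite -cardE -cAB ?finset.pblock_mem // cardE index_mem mem_enum.
  by rewrite inE aA finset.mem_pblock covP.
have phiBC a : a \in A -> phi a \in B :&: C a.
  by move=> aA; rewrite -mem_enum mem_nth ?idx.
exists phi; split=> [a b aA bA phiab|a aA]; last first.
  have /setIP[-> phiC] := phiBC a aA; split=> //.
  by exists (C a); rewrite ?finset.pblock_mem // phiC finset.mem_pblock covP.
have /setIP[_ aC] := phiBC a aA; have /setIP[_ bC] := phiBC b bA.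
have Cab : C a = C b.
  rewrite /C -(finset.def_pblock tP (finset.pblock_mem (covP a)) aC) phiab.
  exact: (finset.def_pblock tP (finset.pblock_mem (covP b)) bC).
have bAa : b \in A :&: C a by rewrite inE bA Cab finset.mem_pblock covP.
have aAa : a \in A :&: C a by rewrite inE aA finset.mem_pblock covP.
move: phiab; rewrite /phi -Cab (set_nth_default b) ?idx // => /eqP.
rewrite nth_uniq ?enum_uniq ?idx //; last by rewrite Cab idx.
by move/eqP/(congr1 (nth a (enum (A :&: C a)))); rewrite !nth_index ?mem_enum.
Qed.

(** Lying in the same block of an equitable partition is a witness for
    coinduction, because block counts give the required injections. *)
Lemma equitable_succeq (P : {set {set 'I_N}}) i j :
  equitable e P -> same_block P i j -> succeq e i j.
Proof.
case=> PP eqP; apply: succeq_coind => {}i {}j /eqP cij.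
by apply: block_injection => // C CP; rewrite cij.
Qed.

Lemma same_blockC (P : {set {set 'I_N}}) i j : same_block P i j -> same_block P j i.
Proof. by case=> B BP ijB; exists B; rewrite // andbC. Qed.

Lemma equitable_cong (P : {set {set 'I_N}}) i j :
  equitable e P -> same_block P i j -> cong e i j.
Proof.
by move=> eP ij; split; apply: (equitable_succeq eP) => //; apply: same_blockC.
Qed.

Definition cong_partition : {set {set 'I_N}} :=
  equivalence_partition (fun i j => `[< cong e i j >]) [set: 'I_N].

Let cong_equiv : {in [set: 'I_N] & &,
  equivalence_rel (fun i j => `[< cong e i j >])}.
Proof.
move=> i j k _ _ _; split; first by apply/asboolP; apply: cong_refl.
move=> /asboolP ij; apply/asboolP/asboolP; last exact: cong_trans.
by apply: cong_trans; apply: cong_sym.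
Qed.

Lemma cong_partitionP : finset.partition cong_partition [set: 'I_N].
Proof. exact: equivalence_partitionP cong_equiv. Qed.

Lemma same_block_cong i j : same_block cong_partition i j <-> cong e i j.
Proof.
rewrite (same_block_pblock _ _ cong_partitionP).
by rewrite pblock_equivalence_partition ?inE //; split=> /asboolP.
Qed.

Lemma cong_partition_class B : B \in cong_partition -> exists i, B = cong_class i.
Proof.
case/imsetP=> i _ ->; exists i; apply/setP => j; rewrite !inE //.
Qed.

Lemma cong_partition_equitable : equitable e cong_partition.
Proof.
split=> [|i j]; first exact: cong_partitionP.
rewrite same_block_cong; split=> [cij _ /cong_partition_class[a ->]|cnt].
  exact: cong_card_class.
have half i' j' : (forall B, B \in cong_partition ->
    #|nbrs e j' :&: B| = #|nbrs e i' :&: B|) -> succeq e i' j'.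
  move=> {}cnt; apply: succeq_fold.
  have : nbr_injection (same_block cong_partition) i' j'.
    exact: block_injection cong_partitionP cnt.
  by apply: nbr_injectionW => a b /same_block_cong[].
by split; apply: half => B BP; rewrite cnt.
Qed.

Lemma cong_partition_coarsest : coarsest_equitable e cong_partition.
Proof.
split=> [|Q eQ B BQ]; first exact: cong_partition_equitable.
have /set0Pn[i iB] := finset.partition_neq0 eQ.1 BQ.
exists (finset.pblock cong_partition i).
  by apply: finset.pblock_mem; rewrite (finset.cover_partition cong_partitionP) inE.
apply/fintype.subsetP => j jB; rewrite -same_block_pblock; last exact: cong_partitionP.
apply/same_block_cong/(equitable_cong eQ); exists B => //; exact/andP.
Qed.

Lemma cong_nbr_injection i j : cong e i j -> nbr_injection (cong e) i j.
Proof.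
move=> cij; have [PP /(_ j i) [+ _]] := cong_partition_equitable.
move=> /(_ ((same_block_cong _ _).2 (cong_sym cij))) cnt.
by apply: nbr_injectionW (block_injection PP cnt) => a b /same_block_cong.
Qed.

Lemma cong_deg i j : cong e i j -> deg e i = deg e j.
Proof.
move=> [/succeq_step ij /succeq_step ji].
by apply/eqP; rewrite eqn_leq (nbr_injection_deg ij) (nbr_injection_deg ji).
Qed.

End Walks.

(** * Gronwall's inequality *)

Section Gronwall.
Local Open Scope classical_set_scope.
Variable R : realType.
Implicit Types (f df : R -> R) (t C L T : R).

(** The function [f t * expR (- C * t)] is nonincreasing, since its derivative is
    [expR (- C * t) * (df t - C * f t)]. *)
Lemma gronwall_le0 f df C T :
  (forall t, 0 < t < T -> is_derive t 1 f (df t)) ->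
  (forall t, 0 < t < T -> df t <= C * f t) ->
  {within `[0, T], continuous f} -> f 0 <= 0 ->
  forall t, 0 <= t <= T -> f t <= 0.
Proof.
move=> fdf dfC fc f0 t t0T.
pose w (s : R) : R := expR (- C * s).
have dw (s : R) : is_derive s 1 w (- C * w s).
  have dlin : is_derive s 1 (fun x : R => - C * x) (- C).
    apply: (@is_derive_eq _ _ _ _ _ _ _ _ (is_deriveZ (- C) (is_derive_id s 1))).
    by rewrite /GRing.scale /= mulr1.
  apply: (@is_derive_eq _ _ _ _ _ _ _ _ (is_derive1_comp (is_derive_expR _) dlin)).
  by rewrite mulrC.
have dfw s : 0 < s < T ->
    is_derive s 1 (f * w) (f s *: (- C * w s) + w s *: df s).
  by move=> s0T; apply: is_deriveM; exact: fdf.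
have wc : {within `[0, T], continuous w}.
  by apply: derivable_within_continuous => s _; exact: ex_derive.
have [t0 tT] := andP t0T.
have T0 : 0 <= T by exact: le_trans tT.
have := @ler0_derive1_le_cc _ (f * w) 0 T _ _ _ t 0.
rewrite !in_itv /= t0T lexx T0 => /(_ _ _ _ isT isT t0) fw.
have : f t * w t <= f 0 * w 0.
  apply: fw.
  - by move=> s; rewrite in_itv /= => /dfw ds; exact: ex_derive.
  - move=> s; rewrite in_itv /= => s0T; have ds := dfw s s0T; rewrite derive1E derive_val.
    rewrite /GRing.scale /=.
    have -> : f s * (- C * w s) + w s * df s = w s * (df s - C * f s) by ring.
    by rewrite mulr_ge0_le0 ?expR_ge0 // subr_le0 dfC.
  - by move=> x; apply: continuousM; [exact: fc|exact: wc].
rewrite /w mulr0 expR0 mulr1 => fw0.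
by rewrite -(pmulr_lle0 _ (expR_gt0 (- C * t))) (le_trans fw0).
Qed.

Lemma sqr_sum_le (I : finType) (x : I -> R) :
  (\sum_p `|x p|) ^+ 2 <= #|I|%:R * \sum_p x p ^+ 2.
Proof.
have Ex : \sum_(p : I) \sum_(q : I) x p ^+ 2 = #|I|%:R * \sum_p x p ^+ 2.
  rewrite mulr_sumr; apply: eq_bigr => p _.
  by rewrite sumr_const mulr_natl.
have Ey : \sum_(p : I) \sum_(q : I) x q ^+ 2 = #|I|%:R * \sum_p x p ^+ 2.
  by rewrite exchange_big.
have E2 : \sum_p \sum_q (x p ^+ 2 + x q ^+ 2) = 2 * (#|I|%:R * \sum_p x p ^+ 2).
  under eq_bigr do rewrite big_split /=.
  by rewrite big_split /= Ex Ey [RHS]mulr_natl mulr2n.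
rewrite -(ler_pM2l (_ : 0 < 2)) // -E2.
rewrite expr2 mulr_suml mulr_sumr; apply: ler_sum => p _.
rewrite mulr_sumr mulr_sumr; apply: ler_sum => q _ /=.
rewrite -[x p ^+ 2]real_normK ?num_real // -[x q ^+ 2]real_normK ?num_real //.
have := sqr_ge0 (`|x p| - `|x q|); nra.
Qed.

Lemma is_derive_bigsum (I : finType) (u : I -> R -> R) (du : I -> R) t :
  (forall p, is_derive t 1 (u p) (du p)) ->
  is_derive t 1 (\sum_p u p) (\sum_p du p).
Proof.
move=> udu; elim/big_ind2 : _ => // [|? ? ? ?]; last exact: is_deriveD.
exact: is_derive_cst.
Qed.

(** The scalar inequality is applied to the sum of the squares of the [u p], which
    unlike the sum of their absolute values is differentiable;
    [sqr_sum_le] is what converts one into the other. *)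
Lemma gronwall_eq0 (I : finType) (u du : I -> R -> R) L T : 0 <= L ->
  (forall p t, 0 < t < T -> is_derive t 1 (u p) (du p t)) ->
  (forall p t, 0 < t < T -> `|du p t| <= L * \sum_q `|u q t|) ->
  (forall p, {within `[0, T], continuous (u p)}) ->
  (forall p, u p 0 = 0) ->
  forall p t, 0 <= t <= T -> u p t = 0.
Proof.
move=> L0 udu duL uc u0 p t t0T.
pose f : R -> R := \sum_p (u p * u p).
pose df s := \sum_p (u p s *: du p s + u p s *: du p s).
have fE s : f s = \sum_p u p s ^+ 2 by rewrite /f fct_sumE.
suff : f t <= 0.
  rewrite fE => ft; apply/eqP; rewrite -sqrf_eq0; apply/eqP.
  have ft0 : \sum_p u p t ^+ 2 = 0.
    by apply/eqP; rewrite eq_le ft sumr_ge0 // => q _; exact: sqr_ge0.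
  by apply: (psumr_eq0P _ ft0) => // q _; exact: sqr_ge0.
apply: (@gronwall_le0 f df (2 * L * #|I|%:R) T) => //.
- by move=> s s0T; apply: is_derive_bigsum => q; apply: is_deriveM; exact: udu.
- move=> s s0T; rewrite fE.
  have dle q : u q s *: du q s + u q s *: du q s <=
      2 * `|u q s| * (L * \sum_r `|u r s|).
    have : u q s * du q s <= `|u q s| * (L * \sum_r `|u r s|).
      apply: le_trans (ler_norm _) _; rewrite normrM ler_wpM2l //; exact: duL.
    rewrite /GRing.scale /= -mulrA; lra.
  apply: le_trans (ler_sum _ (fun q _ => dle q)) _.
  rewrite -mulr_suml -mulr_sumr.
  have := sqr_sum_le (u ^~ s); set W := \sum_(_ | _) `|_| => WE.
  have -> : 2 * W * (L * W) = 2 * L * W ^+ 2 by ring.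
  by rewrite -[leRHS]mulrA ler_wpM2l // mulr_ge0.
- move=> x; rewrite /f; elim/big_ind : _ => [|g h gc hc|q _].
  + exact: cvg_cst.
  + exact: continuousD.
  + by apply: continuousM; exact: uc.
- by rewrite fE big1 // => q _; rewrite u0 expr0n.
Qed.

End Gronwall.

(** * The logistic system *)

Section Logistic.
Local Open Scope classical_set_scope.
Variables (R : realType) (N : nat) (e : rel 'I_N) (gamma : R).
Implicit Types (t M T : R) (x : 'I_N -> R) (y : 'I_N -> R -> R) (i j : 'I_N).

(** Extending the difference by 0 to pairs that are not [cong]-equivalent gives a
    family indexed by a plain finite type. *)
Definition cong_gap x (p : 'I_N * 'I_N) : R :=
  if `[< cong e p.1 p.2 >] then x p.1 - x p.2 else 0.

(** Matching neighbours by a [cong]-preserving bijection turns the difference of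
    the two sums into a sum of differences over [cong]-equivalent pairs. *)
Lemma nbr_sum_cong x i j : 0 <= gamma -> cong e i j ->
  `|\sum_(k | e i k) gamma * x k - \sum_(k | e j k) gamma * x k| <=
  gamma * \sum_p `|cong_gap x p|.
Proof.
move=> g0 cij.
have [phi [phiI phiS]] := cong_nbr_injection cij.
(* An injection between sets of equal size is onto. *)
have phiE : phi @: nbrs e j = nbrs e i.
  apply/eqP; rewrite eqEcard card_in_imset // -/(deg e i) -/(deg e j).
  rewrite (cong_deg cij) leqnn andbT.
  by apply/fintype.subsetP => _ /imsetP[a /phiS[? _] ->].
have -> : \sum_(k | e i k) gamma * x k =
    \sum_(a in nbrs e j) gamma * x (phi a).
  rewrite -(big_imset (fun k => gamma * x k) phiI) phiE.
  by apply: eq_bigl => k; rewrite inE.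
have -> : \sum_(k | e j k) gamma * x k = \sum_(a in nbrs e j) gamma * x a.
  by apply: eq_bigl => k; rewrite inE.
rewrite -sumrB (eq_bigr (fun a => gamma * cong_gap x (phi a, a))); last first.
  by move=> a /phiS[_ ca]; rewrite /cong_gap /= asboolT // mulrBr.
rewrite -mulr_sumr normrM ger0_norm // ler_wpM2l //.
apply: le_trans (ler_norm_sum _ _ _) _.
rewrite (eq_bigr (fun p => `|cong_gap x (p.1, p.2)|)); last by case.
rewrite -(pair_big xpredT xpredT (fun b a => `|cong_gap x (b, a)|)) /=.
rewrite exchange_big /= [leRHS](bigID (mem (nbrs e j))) /= ler_wpDr //.
  by do 2![apply: sumr_ge0 => ? _].
apply: ler_sum => a _; rewrite (bigD1 (phi a)) //= ler_wpDr //.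
by apply: sumr_ge0.
Qed.

(** With [Si] and [Sj] the two weighted neighbour sums, the difference is
    [(Si - Sj) * (1 - x i) - (Sj + 1) * (x i - x j)]; each summand contains a
    factor controlled by the gaps. *)
Lemma logistic_rhs_cong x M i j : 0 <= gamma -> (forall k, `|x k| <= M) ->
  cong e i j ->
  `|logistic_rhs e gamma x i - logistic_rhs e gamma x j| <=
  (gamma * (1 + M) + N%:R * (gamma * M) + 1) * \sum_p `|cong_gap x p|.
Proof.
move=> g0 xM cij; rewrite /logistic_rhs.
have := nbr_sum_cong x g0 cij.
set Si := \sum_(k | e i k) _; set Sj := \sum_(k | e j k) _; set W := \sum_p _.
move=> SW.
have SjM : `|Sj| <= N%:R * (gamma * M).
  apply: le_trans (ler_norm_sum _ _ _) _.
  have -> : N%:R * (gamma * M) = \sum_(k < N) gamma * M.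
    by rewrite sumr_const card_ord mulr_natl.
  rewrite [leRHS](bigID (e j)) /= ler_wpDr //.
    apply: sumr_ge0 => k _; apply: mulr_ge0 => //.
    exact: le_trans (normr_ge0 _) (xM k).
  by apply: ler_sum => k _; rewrite normrM (ger0_norm g0) ler_wpM2l.
have uW : `|x i - x j| <= W.
  rewrite /W (bigD1 (i, j)) //= {1}/cong_gap /= asboolT // lerDl.
  by apply: sumr_ge0.
have -> : Si * (1 - x i) - x i - (Sj * (1 - x j) - x j) =
    (Si - Sj) * (1 - x i) - (Sj + 1) * (x i - x j) by ring.
have xi1 : `|1 - x i| <= 1 + M.
  by apply: le_trans (ler_normB _ _) _; rewrite normr1 lerD2l.
have Sj1 : `|Sj + 1| <= N%:R * (gamma * M) + 1.
  by apply: le_trans (ler_normD _ _) _; rewrite normr1 lerD2r.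
apply: le_trans (ler_normB _ _) _; rewrite !normrM.
have -> : (gamma * (1 + M) + N%:R * (gamma * M) + 1) * W =
  gamma * W * (1 + M) + (N%:R * (gamma * M) + 1) * W by ring.
by apply: lerD; apply: ler_pM.
Qed.

Lemma logistic_solution_continuous y i T : 0 < T ->
  logistic_solution e gamma y -> {within `[0, T], continuous (y i)}.
Proof.
move=> T0 /(_ i)[dy dy0].
have yc t : 0 < t -> {for t, continuous (y i)}.
  move=> /dy dyt; apply: differentiable_continuous; apply/derivable1_diffP.
  exact: ex_derive.
apply/continuous_within_itvP => //; split.
- by move=> t; rewrite in_itv /= => /andP[/yc].
(* Right continuity at 0: [y i h] is [y i 0] plus [h] times the difference
   quotient, which converges. *)
- have h0 : (h : R) @[h --> 0^'+] --> (0 : R) by exact: cvg_within.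
  pose g (h : R) := y i 0 + h * (h^-1 * (y i h - y i 0)).
  have gc : g x @[x --> 0^'+] --> y i 0.
    rewrite -[X in _ --> X]addr0 -[X in _ + X](mul0r (logistic_rhs e gamma (y ^~ 0) i)).
    by apply: cvgD; [exact: cvg_cst|exact: cvgM].
  have gy : y i x @[x --> 0^'+] `=>` g x @[x --> 0^'+]; last exact: cvg_trans gy gc.
  apply: near_eq_cvg.
  near=> h; rewrite /g /= mulVKf ?subrKC //.
- exact/cvg_at_left_filter/yc.
Unshelve. all: by end_near.
Qed.

Lemma within_continuous_bounded (I : finType) (f : I -> R -> R) (T : R) :
  0 <= T ->
  (forall p, {within `[0, T], continuous (f p)}) ->
  exists M, forall p t, 0 <= t <= T -> `|f p t| <= M.
Proof.
move=> T0 fc.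
pose g : R -> R := \sum_p (fun t => `|f p t|).
have gc : {within `[0, T], continuous g}.
  move=> x; rewrite /g; elim/big_ind : _ => [|a b ac bc|q _].
  - exact: cvg_cst.
  - exact: continuousD.
  - exact: (cvg_norm (fc q x)).
have [c _ cmax] := EVT_max T0 gc; exists (g c) => p t t0T.
apply: le_trans (cmax t _); last by rewrite in_itv.
 rewrite /g fct_sumE (bigD1 p) //= lerDl.
by apply: sumr_ge0.
Qed.

Lemma logistic_solution_cong y t i j : 0 <= gamma ->
  logistic_solution e gamma y ->
  (forall i j, cong e i j -> y i 0 = y j 0) ->
  0 <= t -> cong e i j -> y i t = y j t.
Proof.
move=> g0 sol y0; rewrite le_eqVlt => /predU1P[<-|T0] cij; first exact: y0.
have yc k := logistic_solution_continuous (i := k) T0 sol.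
have [M yM] := within_continuous_bounded (ltW T0) yc.
have M0 : 0 <= M.
  by apply: le_trans (normr_ge0 (y i t)) (yM _ _ _); rewrite lexx ltW.
have L0 : 0 <= gamma * (1 + M) + N%:R * (gamma * M) + 1.
  by rewrite !addr_ge0 // !mulr_ge0 // addr_ge0.
pose u p s := cong_gap (y ^~ s) p.
pose du p s := cong_gap (logistic_rhs e gamma (y ^~ s)) p.
have := @gronwall_eq0 R _ u du
  (gamma * (1 + M) + N%:R * (gamma * M) + 1) t L0 _ _ _ _ (i, j) t.
rewrite /u /cong_gap /= asboolT // => gron.
apply/eqP; rewrite -subr_eq0; apply/eqP/gron => {gron}.
- move=> [a b] s /andP[s0 _].
  rewrite /u /du /cong_gap /=; case: ifP => _; last exact: is_derive_cst.
  by apply: is_deriveB; apply: (sol _).1.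
- move=> [a b] s /andP[s0 sT]; rewrite /du {1}/cong_gap /=.
  case: asboolP => cab; last by rewrite normr0 mulr_ge0 // sumr_ge0.
  by apply: logistic_rhs_cong => // k; apply: yM; rewrite !ltW.
- move=> [a b]; rewrite /u /cong_gap /=; case: `[< cong e a b >] => x;
    last exact: cvg_cst.
  by apply: continuousB; apply: yc.
- move=> [a b]; rewrite /u /cong_gap /=; case: ifP => // /asboolP cab.
  by rewrite (y0 _ _ cab) subrr.
- by rewrite lexx ltW.
Qed.

End Logistic.

Theorem corollary20 (R : realType) (N : nat) (e : rel 'I_N)
    (e_sym : symmetric e) (e_irr : irreflexive e)
    (gamma : R) (gamma_gt0 : 0 < gamma) :
  (exists P : {set {set 'I_N}},
     coarsest_equitable e P /\
     forall i j : 'I_N, same_block P i j <-> cong e i j) /\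
  (forall y : 'I_N -> R -> R,
     logistic_solution e gamma y ->
     (forall i : 'I_N, 0 <= y i 0 <= 1) ->
     (forall i j : 'I_N, cong e i j -> y i 0 = y j 0) ->
     forall t : R, 0 <= t ->
     forall i j : 'I_N, cong e i j -> y i t = y j t).
Proof.
split.
  exists (cong_partition e); split; first exact: cong_partition_coarsest.
  exact: same_block_cong.
move=> y sol _ y0 t t0 i j.
exact: logistic_solution_cong (ltW gamma_gt0) sol y0 t0.
Qed.
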